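(* Let $d>0$ be an integer with $-d\equiv 2,3\pmod 4$, let $M=\mathbb{Q}(i\sqrt{d})$ with ring of integers $\mathbb{Z}_M$, let $t\in\mathbb{Z}_M$, let $\xi$ be a root of the polynomial $$f(x)=x^4-t^2x^2+1,$$ and let $\mathcal{O}=\mathbb{Z}_M[\xi]$. If $|t|>245$, then the order $\mathcal{O}$ admits no power integral bases.
   Context: $\mathcal{O}$ is regarded as an order of the octic field $K=M(\xi)$. The order $\mathcal{O}$ admits a power integral basis if there exists $\alpha\in\mathcal{O}$ with $\mathcal{O}=\mathbb{Z}[\alpha]$. $|t|$ is the complex absolute value. *)

(* Defs.v *)
(* Number fields are realised as subfields of [algC], so that
   `|_| is the usual complex absolute value. *)
From HB Require Import structures.
From mathcomp Require Import all_boot all_order all_algebra all_field.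

Set Implicit Arguments.
Unset Strict Implicit.
Unset Printing Implicit Defensive.

Import Order.TTheory GRing.Theory Num.Theory.
Local Open Scope ring_scope.

(* S[a], when S is (the underlying set of) a subring of algC. *)
Definition ring_adjoin (S : algC -> Prop) (a z : algC) : Prop :=
  exists p : {poly algC}, (forall k : nat, S p`_k) /\ z = p.[a].

(* F(a), when F is a subfield of algC. *)
Definition field_adjoin (F : algC -> Prop) (a z : algC) : Prop :=
  exists x y : algC,
    [/\ ring_adjoin F a x, ring_adjoin F a y, y != 0 & z = x / y].

Definition in_Z (z : algC) : Prop := z \in Num.int.

Definition in_Q (z : algC) : Prop := z \in Crat.

Definition ring_of_integers (F : algC -> Prop) (z : algC) : Prop :=
  F z /\ z \in Aint.

(* M = Q(i sqrt d); d need not be squarefree, and [ring_of_integers (M_ d)] is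
   then still the maximal order of M, not Z[i sqrt d]. *)
Definition M_ (d : int) : algC -> Prop :=
  field_adjoin in_Q ('i * sqrtC d%:~R).

Definition ZM_ (d : int) : algC -> Prop := ring_of_integers (M_ d).

Definition has_power_integral_basis (O : algC -> Prop) : Prop :=
  exists alpha : algC,
    O alpha /\ (forall z : algC, O z <-> ring_adjoin in_Z alpha z).

(* Main.v *)
Require Import Defs.
From HB Require Import structures.
From mathcomp Require Import all_boot all_order all_algebra all_field.
From mathcomp Require Import zify ring.

Set Implicit Arguments.
Unset Strict Implicit.
Unset Printing Implicit Defensive.

Import Order.TTheory GRing.Theory Num.Theory.
Local Open Scope ring_scope.

(** The obstruction to a power integral basis is local at the prime 2.

Since d is 1 or 2 modulo 4, the prime 2 ramifies in M: every integer of M is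
a + y i sqrt d with a a rational integer ([quad_int_coords]), so its square is
congruent to minus its norm, a rational integer, modulo 2 Z_M
([quad_int_sqr]).  Squaring is additive modulo 2, hence the square of any
element of O = Z_M[xi] lies in Z + Z xi^2 modulo 2O, and xi^2 is itself
quadratic over Z modulo 2.  It follows that every alpha in O satisfies a monic
congruence alpha^4 = u + v alpha^2 modulo 2O with u and v in Z ([pow4_mod2]).

If O were Z[alpha], this congruence would make O/2O an F_2-space of dimension
at most 4: any five elements of O would have an integer combination, with a
coefficient that is odd, lying in 2O ([adjoin_int_relation]).  The elements
1, xi, xi^2, xi^3 and i sqrt d admit no such combination.  Indeed xi has
degree 4 over M ([quartic_indep]), so the coefficients of xi, xi^2 and xi^3
would have to be even, and so would both k and l in k + l i sqrt d, because
this number would be twice an integer of M ([quad_int_half]).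

That xi has degree 4 over M is where the size of t comes in.  If the degree
dropped, t^4 - 4, t^2 + 2 or t^2 - 2 would be a square in M.  But a nonzero
integer of M has absolute value at least 1, so two squares of Z_M with a small
nonzero difference have small roots ([diff_sqr_norm]). *)

(** * Degree four over a subfield *)

Lemma lin_indep (L : fieldType) (M : divringClosed L) (x a b : L) :
  x \notin M -> a \in M -> b \in M -> a + b * x = 0 -> a = 0 /\ b = 0.
Proof.
move=> xM aM bM /eqP; rewrite addr_eq0 => /eqP e.
have b0 : b = 0.
  apply: contraNeq xM => b0.
  have -> : x = - a / b by rewrite e opprK mulrC mulKf.
  by rewrite rpred_div ?rpredN.
by move: e; rewrite b0 mul0r oppr0.
Qed.

(** As x^2 is quadratic over M, a relation of degree at most 3 would put x in
M(x^2), say x = u + v x^2 with u and v in M.  Comparing coefficients in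
x^2 = (u + v x^2)^2 gives u = v or u = -v and v^2 (t^2 +- 2) = 1, so that
t^2 + 2 or t^2 - 2 would be a square in M. *)
Lemma quartic_indep (L : fieldType) (M : divringClosed L) (t x : L) :
    t \in M -> x ^+ 4 = t ^+ 2 * x ^+ 2 - 1 -> x ^+ 2 \notin M ->
    (forall s, s \in M -> s ^+ 2 != t ^+ 2 + 2) ->
    (forall s, s \in M -> s ^+ 2 != t ^+ 2 - 2) ->
  forall a b c e, a \in M -> b \in M -> c \in M -> e \in M ->
    a + b * x + c * x ^+ 2 + e * x ^+ 3 = 0 -> [/\ a = 0, b = 0, c = 0 & e = 0].
Proof.
move=> tM x4 yM sp sm a b c e aM bM cM eM rel.
set y := x ^+ 2 in yM; have x4y : y ^+ 2 = t ^+ 2 * y - 1 by rewrite -x4 /y; ring.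
have rel' : a + c * y + (b + e * y) * x = 0 by rewrite -rel /y; ring.
have [be0|be0] := eqVneq (b + e * y) 0.
  have [-> ->] := lin_indep yM bM eM be0.
  by move: rel'; rewrite be0 mul0r addr0 => /(lin_indep yM aM cM)[-> ->].
(* t^2 - y is the conjugate of y over M, and n below a norm from M(y) to M *)
have be0' : b + e * (t ^+ 2 - y) != 0.
  apply: contraNneq be0 => h.
  have tM2 : b + e * t ^+ 2 \in M by rewrite rpredD ?rpredM ?rpredX.
  have [] := @lin_indep L M y (b + e * t ^+ 2) (- e) yM tM2.
  - by rewrite rpredN.
  - by rewrite -h; ring.
  move=> h1 /eqP; rewrite oppr_eq0 => /eqP e0.
  by move: h1; rewrite e0 !mul0r !addr0 => ->.
set n := b ^+ 2 + t ^+ 2 * b * e + e ^+ 2.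
have nE : (b + e * y) * (b + e * (t ^+ 2 - y)) = n.
  transitivity (n + e ^+ 2 * (t ^+ 2 * y - 1 - y ^+ 2)); first by rewrite /n; ring.
  by rewrite x4y subrr mulr0 addr0.
have n0 : n != 0 by rewrite -nE mulf_neq0.
have nM : n \in M by rewrite !rpredD ?rpredM ?rpredX.
pose u := - (a * b + a * e * t ^+ 2 + c * e) / n.
pose v := - (c * b - a * e) / n.
have uM : u \in M by rewrite rpred_div ?rpredN ?rpredD ?rpredM ?rpredX.
have vM : v \in M by rewrite rpred_div ?rpredN ?rpredB ?rpredM.
have xE : x = u + v * y.
  apply: (mulfI n0).
  have -> : n * (u + v * y)
     = - (a * b + a * e * t ^+ 2 + c * e) - (c * b - a * e) * y.
    by rewrite /u /v; field.
  have h : (b + e * y) * x = - (a + c * y).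
    by apply/eqP; rewrite -addr_eq0 addrC; apply/eqP.
  rewrite -nE mulrAC h.
  transitivity (- (a * b + a * e * t ^+ 2 + c * e) - (c * b - a * e) * y
      + c * e * (y ^+ 2 - (t ^+ 2 * y - 1))); first by ring.
  by rewrite x4y subrr mulr0 addr0.
clearbody u v.
have h : (u ^+ 2 - v ^+ 2) + (2 * u * v + t ^+ 2 * v ^+ 2 - 1) * y = 0.
  transitivity ((u + v * y) ^+ 2 - y - v ^+ 2 * (y ^+ 2 - (t ^+ 2 * y - 1))).
    by ring.
  by rewrite x4y -xE /y; ring.
have [] := lin_indep yM _ _ h; rewrite ?(rpredB, rpredD, rpredM, rpredX, rpred1, rpred_nat) //.
move=> /eqP; rewrite subr_sqr mulf_eq0 subr_eq0 addr_eq0 => uv.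
move=> /eqP; rewrite subr_eq0 => /eqP h1.
have v0 : v != 0.
  apply: contra_eq_neq h1 => ->; rewrite mulr0 expr0n mulr0 addr0 eq_sym.
  exact: oner_neq0.
have viM : v^-1 \in M by rewrite rpredV.
case/orP: uv => /eqP uE.
  case/eqP: (sp _ viM); apply: (mulIf (expf_neq0 2 v0)).
  by rewrite -exprMn mulVf // expr1n -[LHS]h1 uE; ring.
case/eqP: (sm _ viM); apply: (mulIf (expf_neq0 2 v0)).
by rewrite -exprMn mulVf // expr1n -[LHS]h1 uE; ring.
Qed.

(** * Adjoining an element to a subring *)

(** [ring_adjoin] with a boolean set of coefficients, which gives access to
[polyOver] and to the closure properties of subrings. *)
Definition adjoin (S : {pred algC}) (a : algC) : algC -> Prop :=
  ring_adjoin (fun z => z \in S) a.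

Section Adjoin.
Variables (S : subringClosed algC) (a : algC).

Lemma adjoinP z : adjoin S a z <-> exists2 p, p \is a polyOver S & z = p.[a].
Proof.
split=> [[p [/polyOverP pS ->]]|[p /polyOverP pS ->]]; first by exists p.
by exists p; split.
Qed.

Lemma adjoin_base z : z \in S -> adjoin S a z.
Proof. by move=> zS; apply/adjoinP; exists z%:P; rewrite ?polyOverC ?hornerC. Qed.

Lemma adjoin_gen : adjoin S a a.
Proof. by apply/adjoinP; exists 'X; rewrite ?polyOverX ?hornerX. Qed.

Lemma adjoin_int (n : int) : adjoin S a n%:~R.
Proof. by apply: adjoin_base; rewrite rpred_int. Qed.

Lemma adjoinD x y : adjoin S a x -> adjoin S a y -> adjoin S a (x + y).
Proof.
move=> /adjoinP[p pS ->] /adjoinP[q qS ->]; apply/adjoinP.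
by exists (p + q); rewrite ?rpredD ?hornerD.
Qed.

Lemma adjoinM x y : adjoin S a x -> adjoin S a y -> adjoin S a (x * y).
Proof.
move=> /adjoinP[p pS ->] /adjoinP[q qS ->]; apply/adjoinP.
by exists (p * q); rewrite ?rpredM ?hornerM.
Qed.

Lemma adjoinN x : adjoin S a x -> adjoin S a (- x).
Proof. by move=> xO; rewrite -mulN1r; apply: adjoinM => //; exact: (adjoin_int (-1)). Qed.

Lemma adjoinB x y : adjoin S a x -> adjoin S a y -> adjoin S a (x - y).
Proof. by move=> xO yO; apply: adjoinD => //; exact: adjoinN. Qed.

Lemma adjoinX x n : adjoin S a x -> adjoin S a (x ^+ n).
Proof.
move=> xO; elim: n => [|n IHn]; first exact: (adjoin_int 1).
by rewrite exprS; exact: adjoinM.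
Qed.

Lemma adjoin_ind (P : algC -> Prop) :
  (forall x y, P x -> P y -> P (x + y)) -> P 0 ->
  (forall c k, c \in S -> P (c * a ^+ k)) ->
  forall z, adjoin S a z -> P z.
Proof.
move=> PD P0 Pm z /adjoinP[p /polyOverP pS ->].
by rewrite horner_coef; apply: big_ind => // i _; exact: Pm.
Qed.

End Adjoin.

Ltac adjoin_tac := by repeat first
  [ assumption | exact: adjoin_int | exact: (adjoin_int _ _ 2) | exact: adjoin_gen
  | apply: adjoinD | apply: adjoinB | apply: adjoinX | apply: adjoinM
  | apply: adjoin_base; assumption].

(** * Congruences modulo 2 in the quartic order *)

Lemma sqr_mod2 (n : int) : exists h : int, n ^+ 2 = n + 2 * h.
Proof.
have : n = 2 * (n %/ 2)%Z \/ n = 2 * (n %/ 2)%Z + 1 by lia.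
case=> ->; move: (n %/ 2)%Z => m; first by exists (m * (2 * m - 1)); ring.
by exists (m * (2 * m + 1)); ring.
Qed.

Lemma adjoin_span (R : subringClosed algC) (t xi : algC) :
    t \in R -> xi ^+ 4 = t ^+ 2 * xi ^+ 2 - 1 ->
  forall z, adjoin R xi z -> exists a b c e,
    [/\ a \in R, b \in R, c \in R & e \in R] /\
    z = a + b * xi + c * xi ^+ 2 + e * xi ^+ 3.
Proof.
move=> tR xi4 z; elim/adjoin_ind: z / => [x y | | r k rR].
- move=> [a [b [c [e [[aR bR cR eR] ->]]]]] [a' [b' [c' [e' [[aR' bR' cR' eR'] ->]]]]].
  exists (a + a'), (b + b'), (c + c'), (e + e').
  by split; [rewrite !rpredD | ring].
- by exists 0, 0, 0, 0; split; [rewrite rpred0 | ring].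
elim: k => [|k [a [b [c [e [[aR bR cR eR] IHk]]]]]].
  by exists r, 0, 0, 0; split; [rewrite rpred0 | ring].
exists (- e), a, (b + e * t ^+ 2), c.
split; first by rewrite rpredN rpredD ?rpredM ?rpredX.
rewrite exprSr mulrA IHk.
transitivity (a * xi + b * xi ^+ 2 + c * xi ^+ 3 + e * xi ^+ 4); first by ring.
by rewrite xi4; ring.
Qed.

(** Modulo 2, z^2 = u + v xi^2 with u, v in Z, and t^2 is some tau in Z.
Therefore xi^4 = tau xi^2 - 1 and, as v^2 = v modulo 2,
z^4 = u^2 + v^2 xi^4 = (u^2 - v^2) + tau v xi^2, which is
(u^2 - v^2 - tau u) + tau z^2. *)
Lemma pow4_mod2 (R : subringClosed algC) (t xi : algC) :
    (forall z, z \in R -> exists (n : int) w, w \in R /\ z ^+ 2 = n%:~R + 2 * w) ->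
    t \in R -> xi ^+ 4 = t ^+ 2 * xi ^+ 2 - 1 ->
  forall z, adjoin R xi z -> exists (u v : int) w,
    adjoin R xi w /\ z ^+ 4 = u%:~R + v%:~R * z ^+ 2 + 2 * w.
Proof.
move=> sqR tR xi4.
have [tau [t1 [t1R t2]]] := sqR t tR.
(* Q z says that z^2 lies in Z + Z xi^2 + 2O; it is additive in z because
   the cross term 2xy of a square vanishes modulo 2 *)
pose Q z := exists (u v : int) w,
  adjoin R xi w /\ z ^+ 2 = u%:~R + v%:~R * xi ^+ 2 + 2 * w.
have Qpow k : exists (u v : int) w,
    adjoin R xi w /\ xi ^+ 2 ^+ k = u%:~R + v%:~R * xi ^+ 2 + 2 * w.
  elim: k => [|k [u [v [w [wO IHk]]]]].
    by exists 1, 0, 0; split; [exact: (adjoin_int _ _ 0) | rewrite expr0; ring].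
  exists (- v), (u + v * tau), (v%:~R * t1 * xi ^+ 2 + w * xi ^+ 2).
  split; first by adjoin_tac.
  rewrite exprS IHk.
  transitivity (u%:~R * xi ^+ 2 + v%:~R * xi ^+ 4 + 2 * w * xi ^+ 2); first by ring.
  by rewrite xi4 t2; ring.
have allQ z : adjoin R xi z -> adjoin R xi z /\ Q z.
  elim/adjoin_ind: z / => [x y | |c k cR].
  - move=> [xO [u [v [w [wO xE]]]]] [yO [u' [v' [w' [wO' yE]]]]].
    split; first by adjoin_tac.
    exists (u + u'), (v + v'), (w + w' + x * y); split; first by adjoin_tac.
    by rewrite sqrrD xE yE; ring.
  - split; first exact: (adjoin_int _ _ 0).
    by exists 0, 0, 0; split; [exact: (adjoin_int _ _ 0) | ring].
  split; first by adjoin_tac.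
  have [n [c1 [c1R cE]]] := sqR c cR.
  have [u [v [w [wO xiE]]]] := Qpow k.
  exists (n * u), (n * v), (n%:~R * w + c1 * (u%:~R + v%:~R * xi ^+ 2 + 2 * w)).
  split; first by adjoin_tac.
  by rewrite exprMn exprAC xiE cE; ring.
move=> z /allQ[zO [u [v [w [wO zE]]]]].
have [h hE] := sqr_mod2 v.
(* W collects the multiples of 2 discarded in the congruence for z^4 *)
pose W := - tau%:~R * w + h%:~R * tau%:~R * xi ^+ 2 + u%:~R * v%:~R * xi ^+ 2
  + (v ^+ 2)%:~R * t1 * xi ^+ 2 + 2 * w ^+ 2 + 2 * w * (u%:~R + v%:~R * xi ^+ 2).
exists (u ^+ 2 - v ^+ 2 - tau * u), tau, W; split.
  rewrite /W -rmorphN; adjoin_tac.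
have -> : z ^+ 4 = (z ^+ 2) ^+ 2 by ring.
have hE' : v%:~R ^+ 2 = v%:~R + 2 * h%:~R :> algC by rewrite -rmorphXn hE; ring.
rewrite {}/W zE.
transitivity (u%:~R ^+ 2 + 2 * u%:~R * v%:~R * xi ^+ 2 + v%:~R ^+ 2 * xi ^+ 4
  + 4 * w ^+ 2 + 4 * w * (u%:~R + v%:~R * xi ^+ 2)); first by ring.
rewrite xi4 t2 !(rmorphB, rmorphXn, rmorphM) /= hE'; ring.
Qed.

(** * Dependence modulo 2 in a monogenic ring *)

(** Over F_2 the n+1 rows are dependent; k lifts to the integers the
coefficients of a dependence. *)
Lemma even_relation n (C : 'M[int]_(n.+1, n)) :
  exists (k : 'rV[int]_n.+1) (l : 'rV[int]_n),
    (exists i, ~~ (2 %| k ord0 i)%Z) /\ k *m C = 2 *: l.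
Proof.
pose f := intr : int -> 'F_2.
have f0 z : (f z == 0) = (2 %| z)%Z.
  by rewrite /f -(dvdz_pcharf (pchar_Fp (isT : prime 2))).
have : kermx (map_mx f C) != 0.
  by rewrite kermx_eq0 /row_free neq_ltn ltnS rank_leq_col.
case/rowV0Pn => v /sub_kermxP vC v0.
pose k := map_mx (fun z : 'F_2 => Posz (nat_of_ord z)) v.
have fk : map_mx f k = v.
  by apply/rowP => i; rewrite !mxE /f -pmulrn natr_Zp.
exists k, (map_mx (fun z => z %/ 2)%Z (k *m C)); split.
  have /rV0Pn[i vi] := v0.
  by exists i; rewrite -f0; move: vi; rewrite -{1}fk mxE.
apply/rowP => j; rewrite [in RHS]mxE [in RHS]mxE; apply/esym.
rewrite mulrC; apply: divzK; rewrite -f0 /=.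
have -> : f ((k *m C) ord0 j) = (map_mx f (k *m C)) ord0 j by rewrite [RHS]mxE.
by rewrite map_mxM fk vC mxE.
Qed.

(** The congruence g(a) = 0 modulo 2 lets one divide by g: every element of
Z[a] is, modulo 2 Z[a], an integer polynomial in a of degree less than n.  So
n+1 elements are dependent over F_2. *)
Lemma adjoin_int_relation n (a : algC) (g : {poly int}) (b : 'I_n.+1 -> algC) :
    g \is monic -> size g = n.+1 ->
    (exists2 w, adjoin Num.int a w & (map_poly intr g).[a] = 2 * w) ->
    (forall i, adjoin Num.int a (b i)) ->
  exists k : 'I_n.+1 -> int, (exists i, ~~ (2 %| k i)%Z) /\
    exists2 w, adjoin Num.int a w & \sum_i (k i)%:~R * b i = 2 * w.
Proof.
move=> g_monic g_size [w wO gE] bO.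
have rem z : adjoin Num.int a z -> exists r : {poly int}, (size r <= n)%N /\
    exists2 w, adjoin Num.int a w & z = (map_poly intr r).[a] + 2 * w.
  move=> /adjoinP[p /floorpP[q ->] ->].
  exists (Pdiv.CommonRing.rmodp q g); split.
    by rewrite -ltnS -g_size Pdiv.CommonRing.ltn_rmodp monic_neq0.
  exists ((map_poly intr (Pdiv.CommonRing.rdivp q g)).[a] * w).
    apply: adjoinM => //; apply/adjoinP; eexists; last by [].
    by apply/polyOverP => i; rewrite coef_map /= intr_int.
  rewrite {1}(Pdiv.RingMonic.rdivp_eq g_monic q) rmorphD rmorphM hornerD hornerM gE /=.
  by ring.
have {rem} rem i := rem _ (bO i).
have [r rP] := fin_all_exists rem.
have [k [l [kodd kl]]] := even_relation (\matrix_(i, j) (r i)`_j).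
exists (k ord0); split=> //.
have [v vO vE] := fin_all_exists2 (fun i => (rP i).2).
pose s := \poly_(j < n) (if insub j is Some j' then l ord0 j' else 0).
have sE : \sum_i k ord0 i *: r i = 2%:P * s.
  apply/polyP => j; rewrite coef_sum coefCM coef_poly.
  case: ltnP => [jn|nj].
    rewrite insubT /=; have /rowP/(_ (Ordinal jn)) := kl.
    rewrite !mxE => <-; apply: eq_bigr => i _; by rewrite !mxE coefZ.
  rewrite mulr0 big1 // => i _; rewrite coefZ nth_default ?mulr0 //.
  exact: leq_trans (rP i).1 nj.
exists ((map_poly intr s).[a] + \sum_i (k ord0 i)%:~R * v i).
  apply: adjoinD.
    apply/adjoinP; eexists; last by [].
    by apply/polyOverP => i; rewrite coef_map /= intr_int.
  apply: (big_ind (adjoin Num.int a)).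
  - exact: (adjoin_int _ _ 0).
  - by move=> x y; exact: adjoinD.
  by move=> i _; apply: adjoinM => //; exact: adjoin_int.
have sE' := congr1 (fun p => (map_poly intr p).[a] : algC) sE.
move: sE'; rewrite rmorphM /= hornerM map_polyC hornerC rmorph_sum horner_sum /= => sE'.
rewrite mulrDr mulr_sumr.
transitivity (\sum_i ((map_poly intr (k ord0 i *: r i)).[a] + 2 * ((k ord0 i)%:~R * v i))).
  apply: eq_bigr => i _; rewrite vE.
  by rewrite map_polyZ hornerZ /=; ring.
by rewrite big_split /= sE'.
Qed.

(** * Integers of an imaginary quadratic field in which 2 ramifies *)

Definition rootN (d : int) : algC := 'i * sqrtC d%:~R.

(** Q(i sqrt d), read off from real and imaginary parts so that membership
is a boolean predicate. *)
Definition quad (d : int) : {pred algC} :=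
  fun z => ('Re z \in Crat) && ('Im z / sqrtC d%:~R \in Crat).

Definition quad_int (d : int) : {pred algC} :=
  fun z => (z \in quad d) && (z \in Aint).

Section ImaginaryQuadratic.

Variables (d : int) (d_gt0 : 0 < d).

Local Notation w := (rootN d).

Lemma sqrt_d_gt0 : 0 < sqrtC (d%:~R : algC).
Proof. by rewrite sqrtC_gt0 ltr0z. Qed.

Lemma sqr_rootN : w ^+ 2 = - d%:~R.
Proof. by rewrite exprMn sqrCi sqrtCK mulN1r. Qed.

Lemma conj_rootN : w^* = - w.
Proof.
by rewrite rmorphM /= conjCi (CrealP _) ?mulNr // gtr0_real // sqrt_d_gt0.
Qed.

Lemma Aint_sqr (z : algC) : z ^+ 2 \in Aint -> z \in Aint.
Proof.
move=> /floorpP[q qE]; have q_monic : map_poly intr q \is @monic algC.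
  by rewrite -qE; have [p [-> p_monic] _] := minCpolyP (z ^+ 2); rewrite map_monic.
apply: (@root_monic_Aint (map_poly intr q \Po 'X^2)).
- by rewrite /root horner_comp hornerXn -qE; exact: root_minCpoly.
- rewrite monicE lead_coef_comp ?size_polyXn // lead_coefXn expr1n mulr1.
  exact: q_monic.
apply/polyOverP => i.
have -> : map_poly intr q \Po 'X^2 = map_poly intr (q \Po 'X^2) :> {poly algC}.
  by rewrite map_comp_poly map_polyXn.
by rewrite coef_map /= intr_int.
Qed.

Lemma rootN_Aint : w \in Aint.
Proof. by apply: Aint_sqr; rewrite sqr_rootN rpredN Aint_int. Qed.

Lemma quadP z : reflect (exists x y, [/\ x \in Crat, y \in Crat & z = x + y * w])
  (z \in quad d).
Proof.
have s0 := sqrt_d_gt0; have sR : sqrtC (d%:~R : algC) \is Num.real by apply: gtr0_real.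
apply: (iffP andP) => [[xQ yQ]|[x [y [xQ yQ ->]]]].
  exists ('Re z), ('Im z / sqrtC d%:~R); split=> //.
  by rewrite {1}[z]Crect /rootN mulrCA divfK ?gt_eqF.
have xR := Creal_Crat xQ; have yR := Creal_Crat yQ.
have -> : x + y * w = x + 'i * (y * sqrtC d%:~R) by rewrite /rootN mulrCA.
have ysR : y * sqrtC d%:~R \is Num.real by rewrite rpredM.
by rewrite Re_rect ?Im_rect // mulfK // gt_eqF.
Qed.

Lemma conj_rect x y : x \in Crat -> y \in Crat -> (x + y * w)^* = x - y * w.
Proof.
by move=> xQ yQ; rewrite rmorphD rmorphM /= conj_rootN !conj_Crat // mulrN.
Qed.

Lemma norm_rect x y : x \in Crat -> y \in Crat ->
  `|x + y * w| ^+ 2 = x ^+ 2 + d%:~R * y ^+ 2.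
Proof.
move=> xQ yQ; rewrite normCK conj_rect //.
transitivity (x ^+ 2 - y ^+ 2 * w ^+ 2); first by ring.
by rewrite sqr_rootN; ring.
Qed.

Lemma quad_divring_closed : divring_closed (quad d).
Proof.
have mulQ z z' : z \in quad d -> z' \in quad d -> z * z' \in quad d.
  move=> /quadP[x [y [xQ yQ ->]]] /quadP[x' [y' [xQ' yQ' ->]]]; apply/quadP.
  exists (x * x' - d%:~R * y * y'), (x * y' + x' * y).
  split; rewrite ?(rpredB, rpredD) ?rpredM ?rpred_int //.
  transitivity (x * x' + y * y' * w ^+ 2 + (x * y' + x' * y) * w); first by ring.
  by rewrite sqr_rootN; ring.
split.
- by apply/quadP; exists 1, 0; rewrite rpred0 rpred1; split=> //; ring.
- move=> _ _ /quadP[x [y [xQ yQ ->]]] /quadP[x' [y' [xQ' yQ' ->]]]; apply/quadP.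
  by exists (x - x'), (y - y'); rewrite !rpredB //; split=> //; ring.
move=> z z' zM z'M; apply: mulQ => //.
have /quadP[x [y [xQ yQ z'E]]] := z'M.
have nQ : `|z'| ^+ 2 \in Crat.
  by rewrite z'E norm_rect // rpredD ?rpredM ?rpredX ?rpred_int.
apply/quadP; exists (x / `|z'| ^+ 2), (- y / `|z'| ^+ 2).
split; rewrite ?rpred_div ?rpredN //.
rewrite invC_norm {2}z'E conj_rect //.
by ring.
Qed.

HB.instance Definition _ :=
  GRing.isDivringClosed.Build algC (quad d) quad_divring_closed.

Lemma quad_int_subring_closed : subring_closed (quad_int d).
Proof.
split.
- by apply/andP; rewrite !rpred1.
- by move=> x y /andP[xM xA] /andP[yM yA]; apply/andP; rewrite !rpredB.
by move=> x y /andP[xM xA] /andP[yM yA]; apply/andP; rewrite !rpredM.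
Qed.

HB.instance Definition _ :=
  GRing.isSubringClosed.Build algC (quad_int d) quad_int_subring_closed.

Lemma rootN_quad_int : w \in quad_int d.
Proof.
apply/andP; rewrite rootN_Aint; split=> //.
by apply/quadP; exists 0, 1; rewrite rpred0 rpred1; split=> //; ring.
Qed.

Lemma M_quad z : M_ d z <-> z \in quad d.
Proof.
split=> [[x [y [[p [pQ ->]] [q [qQ ->]] _ ->]]]|/quadP[x [y [xQ yQ ->]]]].
  have pM (r : {poly algC}) : (forall k, in_Q r`_k) -> r.[w] \in quad d.
    move=> rQ; apply: rpred_horner; last by have /andP[] := rootN_quad_int.
    by apply/polyOverP => k; apply: rpred_Crat; exact: rQ.
  by apply: rpred_div; apply: pM.
exists (x + y * w), 1; split; rewrite ?oner_neq0 ?divr1 //.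
  exists (x%:P + y%:P * 'X); split; last by rewrite !hornerE.
  move=> k; apply/polyOverP; rewrite rpredD ?rpredM ?polyOverC ?polyOverX //.
exists 1; split; last by rewrite hornerC.
by move=> k; apply/polyOverP; rewrite rpred1.
Qed.

Lemma ZM_quad_int z : ZM_ d z <-> z \in quad_int d.
Proof.
by split=> [[/M_quad zM zA]|/andP[/M_quad zM zA]]; [apply/andP; split | split].
Qed.

Lemma quad_int_norm_ge1 z : z \in quad_int d -> z != 0 -> 1 <= `|z|.
Proof.
case/andP => /quadP[x [y [xQ yQ zE]]] zA z0.
have nZ : `|z| ^+ 2 \in Num.int.
  apply: Cint_rat_Aint; last by rewrite normCK rpredM ?Aint_aut.
  by rewrite zE norm_rect // rpredD ?rpredM ?rpredX ?rpred_int.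
have := norm_intr_ge1 nZ (expf_neq0 2 _); rewrite normr_eq0 normrX normr_id => /(_ z0).
by rewrite -(@ler_pXn2r _ 2 _ 1 `|z|) ?nnegrE ?expr1n ?ler01.
Qed.

Hypothesis d_mod4 : (- d = 2 %[mod 4])%Z \/ (- d = 3 %[mod 4])%Z.

Lemma d_form : exists m : int, d = 4 * m + 1 \/ d = 4 * m + 2.
Proof. by exists (d %/ 4)%Z; lia. Qed.

Lemma sqr_mod4 (n : int) :
  ((2 %| n)%Z /\ exists h, n ^+ 2 = 4 * h) \/
  (~~ (2 %| n)%Z /\ exists h, n ^+ 2 = 4 * h + 1).
Proof.
have [n_even|n_odd] := boolP (2 %| n)%Z; [left|right]; split=> //.
  by have /dvdzP[h ->] := n_even; exists (h ^+ 2); ring.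
have -> : n = 2 * (n %/ 2)%Z + 1 by lia.
by exists ((n %/ 2)%Z ^+ 2 + (n %/ 2)%Z); ring.
Qed.

(** The fraction r / s stands for 2y, where x + y i sqrt d is integral with
trace k = 2x and norm n.  If k were odd, s would be odd because r / s is
reduced, and d r^2 would be -1 modulo 4; but d r^2 is 0 or d modulo 4, and d is
1 or 2 modulo 4. *)
Lemma even_trace (k r s n : int) : coprimez r s ->
  4 * n * s ^+ 2 = k ^+ 2 * s ^+ 2 + d * r ^+ 2 -> (2 %| k)%Z.
Proof.
move=> rs e; have [m dE] := d_form.
have [[//]|[_ [k' kE]]] := sqr_mod4 k; exfalso.
have [[r_even [r' rE]]|[_ [r' rE]]] := sqr_mod4 r;
  have [[s_even [s' sE]]|[_ [s' sE]]] := sqr_mod4 s;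
  rewrite kE rE sE in e.
- have : (2 %| gcdz r s)%Z by rewrite dvdz_gcd r_even.
  by rewrite (eqP rs).
- by case: dE => dE; subst d; lia.
- by case: dE => dE; subst d; lia.
- by case: dE => dE; subst d; lia.
Qed.

(** The coordinate y may still have an odd denominator, since d need not be
squarefree. *)
Lemma quad_int_coords z : z \in quad_int d -> exists (a n : int) y,
  [/\ y \in Crat, z = a%:~R + y * w & n%:~R = a%:~R ^+ 2 + d%:~R * y ^+ 2 :> algC].
Proof.
case/andP => /quadP[x [y [xQ yQ zE]]] zA.
have zbA : z^* \in Aint by rewrite Aint_aut.
have zb : z^* = x - y * w by rewrite zE conj_rect.
have /intrP[k kE] : 2 * x \in Num.int.
  apply: Cint_rat_Aint; first by rewrite rpredM ?rpred_nat.
  have -> : 2 * x = z + z^* by rewrite zb zE; ring.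
  by rewrite rpredD.
have /intrP[n nE] : x ^+ 2 + d%:~R * y ^+ 2 \in Num.int.
  apply: Cint_rat_Aint; first by rewrite rpredD ?rpredM ?rpredX ?rpred_int.
  by rewrite -norm_rect // -zE normCK rpredM.
have /CratP[q qE] : 2 * y \in Crat by rewrite rpredM ?rpred_nat.
have q0 : (denq q)%:~R != 0 :> algC by rewrite intr_eq0 denq_neq0.
have : (2 %| k)%Z.
  apply: (@even_trace k (numq q) (denq q) n); first by rewrite coprimezE coprime_num_den.
  apply/eqP; rewrite -(@eqr_int algC) !(rmorphM, rmorphD, rmorphXn) /= -nE -kE; apply/eqP.
  have -> : (numq q)%:~R = 2 * y * (denq q)%:~R :> algC.
    by rewrite qE -[in ratr q](divq_num_den q) fmorph_div /= !ratr_int divfK.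
  by ring.
case/dvdzP => a aE; exists a, n, y.
have xa : x = a%:~R.
  apply: (@mulfI _ 2); first by rewrite pnatr_eq0.
  by rewrite kE aE rmorphM /= mulrC.
by rewrite -xa.
Qed.

(** The trace 2a is even, so z^2 = 2a z - N(z) is -N(z) modulo 2. *)
Lemma quad_int_sqr z : z \in quad_int d ->
  exists (n : int) w, w \in quad_int d /\ z ^+ 2 = n%:~R + 2 * w.
Proof.
move=> zZ; have [a [n [y [yQ zE nE]]]] := quad_int_coords zZ.
exists (- n), (a%:~R * z); split; first by rewrite rpredM ?rpred_int.
rewrite rmorphN /= nE zE.
transitivity (a%:~R ^+ 2 + 2 * a%:~R * y * w + y ^+ 2 * w ^+ 2); first by ring.
by rewrite sqr_rootN; ring.
Qed.

(** Here z = k/2 + (l/2) i sqrt d has integral half-trace, so k is even; its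
norm then gives that d l^2 is divisible by 4, which forces l to be even. *)
Lemma quad_int_half (k l : int) z : z \in quad_int d ->
  k%:~R + l%:~R * w = 2 * z -> (2 %| k)%Z /\ (2 %| l)%Z.
Proof.
move=> zZ e; have [a [n [y [yQ zE nE]]]] := quad_int_coords zZ.
have w0 : w != 0.
  by rewrite mulf_neq0 ?neq0Ci ?gt_eqF ?sqrt_d_gt0.
have e' : k%:~R - l%:~R * w = 2 * (a%:~R - y * w).
  have := congr1 (fun x : algC => x^*) e.
  by rewrite /= [RHS]rmorphM zE /= !conj_rect ?rpred_int // rmorph_nat.
have kE : k = 2 * a.
  apply/eqP; rewrite -(@eqr_int algC) -(inj_eq (@mulfI _ 2 _)) ?pnatr_eq0 //; apply/eqP.
  have -> : 2 * k%:~R = (k%:~R + l%:~R * w) + (k%:~R - l%:~R * w) :> algC by ring.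
  by rewrite e e' zE rmorphM /=; ring.
have lE : l%:~R = 2 * y.
  apply: (mulIf w0); apply: (addrI (k%:~R)); rewrite e zE kE rmorphM /=; ring.
split; first by rewrite kE dvdz_mulr.
have : d * l ^+ 2 = 4 * (n - a ^+ 2).
  apply/eqP; rewrite -(@eqr_int algC) !(rmorphM, rmorphB, rmorphXn) /= lE nE; apply/eqP.
  by ring.
have [m dE] := d_form; have [[//]|[_ [h ->]]] := sqr_mod4 l.
by case: dE => dE; subst d; lia.
Qed.

(** * The order generated by a root of the quartic *)

Section Quartic.

Variables (t xi : algC).
Hypotheses (t_ZM : t \in quad_int d) (t_large : 2%:R < `|t|).
Hypothesis xi4 : xi ^+ 4 = t ^+ 2 * xi ^+ 2 - 1.

Local Notation O := (adjoin (quad_int d) xi).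

Lemma quad_intW : {subset quad_int d <= quad d}.
Proof. by move=> z /andP[]. Qed.

Lemma sqr_quad_int s : s \in quad d -> s ^+ 2 \in quad_int d -> s \in quad_int d.
Proof. by move=> sM /andP[_ s2A]; apply/andP; rewrite Aint_sqr. Qed.

(** Put p = |a - b| and q = |a + b|.  Both are at least 1, so
2|a| <= p + q <= pq + 1. *)
Lemma diff_sqr_norm (a b : algC) : a \in quad_int d -> b \in quad_int d ->
  a ^+ 2 != b ^+ 2 -> 2 * `|a| <= `|a ^+ 2 - b ^+ 2| + 1.
Proof.
move=> aZ bZ; rewrite -subr_eq0 subr_sqr mulf_eq0 negb_or => /andP[ab0 ab0'].
have h1 := quad_int_norm_ge1 (rpredB aZ bZ) ab0.
have h2 := quad_int_norm_ge1 (rpredD aZ bZ) ab0'.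
have h3 : 2 * `|a| <= `|a - b| + `|a + b|.
  apply: le_trans (ler_normD _ _).
  have -> : a - b + (a + b) = 2 * a by ring.
  by rewrite normrM normr_nat.
apply: le_trans h3 _; rewrite normrM -subr_ge0.
have -> : `|a - b| * `|a + b| + 1 - (`|a - b| + `|a + b|)
  = (`|a - b| - 1) * (`|a + b| - 1) by ring.
by rewrite mulr_ge0 ?subr_ge0.
Qed.

(** Otherwise t^4 - 4, the discriminant of X^2 - t^2 X + 1, would be the
square of an integer s of M. *)
Lemma xi2_notin_quad : xi ^+ 2 \notin quad d.
Proof.
apply/negP => xM; have t2Z : t ^+ 2 \in quad_int d by rewrite rpredX.
have t2M := quad_intW t2Z.
pose s := 2 * xi ^+ 2 - t ^+ 2.
have sE : (t ^+ 2) ^+ 2 - s ^+ 2 = 4.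
  transitivity (4 * (t ^+ 2 * xi ^+ 2 - xi ^+ 4)); first by rewrite /s; ring.
  by rewrite xi4; ring.
have sZ : s \in quad_int d.
  apply: sqr_quad_int; first by apply: rpredB => //; apply: rpredM => //; apply: rpred_nat.
  have -> : s ^+ 2 = (t ^+ 2) ^+ 2 - 4 by rewrite -sE; ring.
  by rewrite rpredB ?rpredX ?rpred_nat.
have := diff_sqr_norm t2Z sZ; rewrite -subr_eq0 sE normrX normr_nat pnatr_eq0.
move=> /(_ isT) /le_gtF /negP[].
(* the bound of diff_sqr_norm reads 2|t|^2 <= 4 + 1, against |t| > 2 *)
apply: (@lt_le_trans _ _ (2 * 2 ^+ 2)).
  by rewrite -!natrX -natrM natr1 ltr_nat.
by rewrite ler_pM2l ?ltr0n // lerXn2r ?nnegrE ?ler0n // ltW.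
Qed.

Lemma sqr_neq_t2 (e : int) s : e != 0 -> (`|e| <= 2) -> s \in quad d ->
  s ^+ 2 != t ^+ 2 + e%:~R.
Proof.
move=> e0 e2 sM; apply/eqP => sE.
have sZ : s \in quad_int d.
  by apply: sqr_quad_int => //; rewrite sE rpredD ?rpredX ?rpred_int.
have := diff_sqr_norm t_ZM sZ.
have eE : t ^+ 2 - s ^+ 2 = (- e)%:~R by rewrite sE rmorphN /=; ring.
rewrite -subr_eq0 eE intr_eq0 oppr_eq0 -intr_norm normrN => /(_ e0) /le_gtF /negP[].
(* the bound of diff_sqr_norm reads 2|t| <= |e| + 1 <= 3 *)
apply: (@le_lt_trans _ _ (2 * 2)); last by rewrite ltr_pM2l ?ltr0n.
apply: (@le_trans _ _ (2%:~R + 1)); first by rewrite lerD2r ler_int.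
by rewrite -natrM -[2%:~R]/(2%:R) natr1 ler_nat.
Qed.

Lemma no_power_integral_basis alpha :
  ~ (O alpha /\ forall z, O z <-> adjoin Num.int alpha z).
Proof.
case=> alphaO OE.
have [u [v [w [wO alpha4]]]] := pow4_mod2 quad_int_sqr t_ZM xi4 alphaO.
pose g : {poly int} := 'X^4 - (v *: 'X^2 + u%:P).
pose r : {poly int} := v *: 'X^2 + u%:P.
have r_size : (size (- r) < 5)%N.
  rewrite size_polyN (leq_ltn_trans (size_polyD _ _)) // gtn_max.
  rewrite (leq_ltn_trans (size_scale_leq _ _)) ?size_polyXn //.
  by rewrite (leq_ltn_trans (size_polyC_leq1 _)).
have g_size : size g = 5%N by rewrite size_polyDl ?size_polyXn.
have g_monic : g \is monic.
  by rewrite monicE lead_coefDl ?lead_coefXn ?size_polyXn.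
have gE : (map_poly intr g).[alpha] = 2 * w.
  rewrite rmorphB rmorphD /= map_polyXn map_polyZ /= map_polyXn map_polyC /=.
  by rewrite !(hornerD, hornerN, hornerZ, hornerXn, hornerC) alpha4; ring.
(* five elements of O that are independent modulo 2O *)
pose b (i : 'I_5) := [:: 1; xi; xi ^+ 2; xi ^+ 3; rootN d]`_i.
have bO i : adjoin Num.int alpha (b i).
  apply/OE; rewrite /b; case: i => i /=.
  case: i => [|[|[|[|[|]]]]] //= _.
  - exact: (adjoin_int _ _ 1).
  - exact: adjoin_gen.
  - by apply: adjoinX; exact: adjoin_gen.
  - by apply: adjoinX; exact: adjoin_gen.
  by apply: adjoin_base; exact: rootN_quad_int.
have wZ : exists2 w, adjoin Num.int alpha w & (map_poly intr g).[alpha] = 2 * w.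
  by exists w => //; apply/OE.
have [k [[i k_odd] [z /OE zO kE]]] := adjoin_int_relation g_monic g_size wZ bO.
have [a0 [a1 [a2 [a3 [[a0Z a1Z a2Z a3Z] zE]]]]] := adjoin_span t_ZM xi4 zO.
pose k_ j : int := k (inord j).
have kE' : (k_ 0)%:~R + (k_ 4)%:~R * rootN d + (k_ 1)%:~R * xi
    + (k_ 2)%:~R * xi ^+ 2 + (k_ 3)%:~R * xi ^+ 3 = 2 * z.
  rewrite -kE (eq_bigr (fun i : 'I_5 => (k_ i)%:~R * [:: 1; xi; xi ^+ 2; xi ^+ 3; rootN d]`_i)).
    by rewrite -(big_mkord xpredT (fun i => (k_ i)%:~R * _`_i)) unlock /=; ring.
  by move=> i' _; rewrite /k_ inord_val.
have half (l : int) (a : algC) : a \in quad_int d -> l%:~R - 2 * a = 0 -> (2 %| l)%Z.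
  move=> aZ /eqP; rewrite subr_eq0 => /eqP la.
  by have [] := @quad_int_half l 0 a aZ; first by rewrite mul0r addr0.
have wM := quad_intW rootN_quad_int.
have kM (l : int) a : a \in quad_int d -> l%:~R - 2 * a \in quad d.
  move=> /quad_intW aM; apply: rpredB; first exact: rpred_int.
  by apply: rpredM => //; exact: rpred_nat.
have kM0 : (k_ 0)%:~R + (k_ 4)%:~R * rootN d - 2 * a0 \in quad d.
  rewrite addrAC; apply: rpredD; first exact: kM.
  by apply: rpredM => //; exact: rpred_int.
have [|||e0 e1 e2 e3] := quartic_indep (quad_intW t_ZM) xi4 xi2_notin_quad _ _ kM0
    (kM (k_ 1) _ a1Z) (kM (k_ 2) _ a2Z) (kM (k_ 3) _ a3Z).
- by move=> s sM; have := @sqr_neq_t2 2 s isT isT sM; rewrite rmorph_nat.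
- by move=> s sM; have := @sqr_neq_t2 (-2) s isT isT sM; rewrite rmorphN rmorph_nat.
- transitivity (2 * z - 2 * z); last by rewrite subrr.
  by rewrite -{1}kE' zE; ring.
have [k0 k4] := quad_int_half a0Z (subr0_eq e0).
move: k_odd; have -> : k i = k_ i by rewrite /k_ inord_val.
case: i => i /=; case: i => [|[|[|[|[|]]]]] //= _; apply/negP; rewrite negbK //.
- exact: half a1Z e1.
- exact: half a2Z e2.
exact: half a3Z e3.
Qed.

End Quartic.
End ImaginaryQuadratic.

Theorem theorem7 (d : int) (d_gt0 : 0 < d)
    (d_mod4 : (- d = 2 %[mod 4])%Z \/ (- d = 3 %[mod 4])%Z)
    (t : algC) (t_ZM : ZM_ d t)
    (xi : algC) (xi_root : root ('X^4 - (t ^+ 2) *: 'X^2 + 1) xi)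
    (t_large : 245%:R < `|t|) :
  ~ has_power_integral_basis (ring_adjoin (ZM_ d) xi).
Proof.
have OE z : ring_adjoin (ZM_ d) xi z <-> adjoin (quad_int d) xi z.
  by split=> -[p [pZ ->]]; exists p; split=> // k; apply/ZM_quad_int.
have xi4 : xi ^+ 4 = t ^+ 2 * xi ^+ 2 - 1.
  move: xi_root; rewrite /root !(hornerD, hornerN, hornerZ, hornerXn, hornerC).
  by move=> /eqP e; apply/eqP; rewrite -subr_eq0 -e; apply/eqP; ring.
have t2 : 2 < `|t| by apply: lt_trans t_large; rewrite ltr_nat.
move=> [alpha [alphaO alphaE]].
have tZ : t \in quad_int d by apply/ZM_quad_int.
apply: (no_power_integral_basis d_gt0 d_mod4 tZ t2 xi4 (alpha := alpha)).
split=> [|z]; first exact/OE.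
by rewrite -OE; exact: alphaE.
Qed.
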